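(* For any real numbers $r<s<t<\infty$ there is a constant $C$ such that for all $u\in B^t(\mathbb{R}^d)$ $$\|u\|_{B^s(\mathbb{R}^d)}\le C\,\|u\|_{B^r(\mathbb{R}^d)}^{\theta}\,\|u\|_{B^t(\mathbb{R}^d)}^{1-\theta},$$ where $0<\theta:=\frac{t-s}{t-r}<1$.
   Context: For $s\in\mathbb{R}$, the spectral Barron space $B^s(\mathbb{R}^d)$ consists of the tempered distributions $u\in\mathcal{S}'(\mathbb{R}^d)$ whose Fourier transform $\hat u$ is a function with $$\|u\|_{B^s(\mathbb{R}^d)}:=\int_{\mathbb{R}^d}|\hat u(\xi)|\,\langle\xi\rangle^{s}\,d\xi<\infty,\qquad \langle\xi\rangle=(1+|\xi|^2)^{1/2}.$$ Equivalently, $B^s(\mathbb{R}^d)$ is the range of $L^{-s/2}$ on $B^0(\mathbb{R}^d)$, where $L=I-\Delta$ and $L^{-s/2}$ is multiplication by $\langle\xi\rangle^{-s}$ in the Fourier domain. *)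

(* Defs.v *)
From HB Require Import structures.
From mathcomp Require Import all_boot all_order all_algebra.
From mathcomp Require Import all_classical all_reals all_analysis.
From mathcomp Require Export complex.

Set Implicit Arguments.
Unset Strict Implicit.
Unset Printing Implicit Defensive.

Import Order.TTheory GRing.Theory Num.Theory.
Import numFieldNormedType.Exports.
Import ComplexField.Normc.

Local Open Scope classical_set_scope.
Local Open Scope ring_scope.

Section rV_measurable.
Context {R : realType} (n : nat).

Let coords : 'I_n -> 'rV[R]_n -> measurableTypeR R := fun i v => v ord0 i.

Let rV_set0 : g_sigma_preimage coords set0.
Proof. exact: sigma_algebra0. Qed.

Let rV_setC A : g_sigma_preimage coords A -> g_sigma_preimage coords (~` A).
Proof. exact: sigma_algebraC. Qed.

Let rV_bigcup (F : _^nat) : (forall i, g_sigma_preimage coords (F i)) ->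
  g_sigma_preimage coords (\bigcup_i (F i)).
Proof. exact: sigma_algebra_bigcup. Qed.

(* The sigma-algebra generated by the coordinates, i.e. the Borel one. *)
HB.instance Definition _ := @isMeasurable.Build
  (measure_tuple_display default_measure_display)
  'rV[R]_n (g_sigma_preimage coords) rV_set0 rV_setC rV_bigcup.

End rV_measurable.

Section lebesgue_rV.
Context {R : realType}.

Lemma measurable_coord n (i : 'I_n) :
  measurable_fun [set: 'rV[R]_n] (fun v => v ord0 i : measurableTypeR R).
Proof.
move=> _ Y mY; rewrite setTI; apply: sub_sigma_algebra => /=.
rewrite -bigcup_seq/=; exists i => /=; first by rewrite mem_index_enum.
by exists Y => //; rewrite setTI.
Qed.

Lemma measurable_fun_rV d (T : measurableType d) n (f : T -> 'rV[R]_n) :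
  (forall i,
    measurable_fun [set: T] (fun x => f x ord0 i : measurableTypeR R)) ->
  measurable_fun [set: T] f.
Proof.
move=> mf _ A mA; pose c i (v : 'rV[R]_n) : measurableTypeR R := v ord0 i.
suff : g_sigma_preimage (fun i => c i \o f) `<=` measurable.
  by rewrite g_sigma_preimage_comp; apply; exists A.
apply: smallest_sub; first exact: sigma_algebra_measurable.
rewrite -bigcup_seq; apply: bigcup_sub => i _ _ [B mB <-].
exact: mf.
Qed.

Definition rV_rcons n (p : 'rV[R]_n * measurableTypeR R) : 'rV[R]_n.+1 :=
  \row_i (if unlift ord_max i is Some j then p.1 ord0 j else p.2).

Lemma measurable_rV_rcons n : measurable_fun [set: _] (@rV_rcons n).
Proof.
apply: measurable_fun_rV => i; rewrite /rV_rcons.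
under eq_fun do rewrite mxE.
case: (unlift ord_max i) => [j|]; last exact: measurable_snd.
exact: (measurableT_comp (measurable_coord j) measurable_fst).
Qed.

Definition lebesgue_rV_step n (mu : {measure set 'rV[R]_n -> \bar R}) :
    set 'rV[R]_n.+1 -> \bar R :=
  pushforward (mu \x @lebesgue_measure R)%E (@rV_rcons n).

Section lebesgue_rV_step_measure.
Context n (mu : {measure set 'rV[R]_n -> \bar R}).

Let step0 : lebesgue_rV_step mu set0 = 0%E.
Proof. by rewrite /lebesgue_rV_step /pushforward preimage_set0 measure0. Qed.

Let step_ge0 A : (0 <= lebesgue_rV_step mu A)%E.
Proof. by apply: integral_ge0 => x _; exact: measure_ge0. Qed.

Let step_sigma_additive : semi_sigma_additive (lebesgue_rV_step mu).
Proof.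
have mf := @measurable_rV_rcons n.
move=> F mF tF mUF; rewrite /lebesgue_rV_step /pushforward preimage_bigcup.
apply: measure_semi_sigma_additive.
- by move=> k; rewrite -[X in measurable X]setTI; exact: mf.
- apply/trivIsetP => /= i j _ _ ij; rewrite -preimage_setI.
  by move/trivIsetP : tF => /(_ _ _ _ _ ij) ->//; rewrite preimage_set0.
- by rewrite -preimage_bigcup -[X in measurable X]setTI; exact: mf.
Qed.

HB.instance Definition _ := isMeasure.Build _ _ _
  (lebesgue_rV_step mu) step0 step_ge0 step_sigma_additive.

End lebesgue_rV_step_measure.

Fixpoint lebesgue_rV n : {measure set 'rV[R]_n -> \bar R} :=
  if n is m.+1 then lebesgue_rV_step (lebesgue_rV m) else \d_(0 : 'rV[R]_0).

End lebesgue_rV.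
Arguments lebesgue_rV : clear implicits.

Section complex_integral.
Context {R : realType} {n : nat}.
Implicit Types f : 'rV[R]_n -> R[i].
Let mu := lebesgue_rV R n.

Definition cmeasurable f :=
  measurable_fun [set: 'rV[R]_n] (fun x => complex.Re (f x)) /\
  measurable_fun [set: 'rV[R]_n] (fun x => complex.Im (f x)).

Definition cintegrable f :=
  mu.-integrable [set: 'rV[R]_n] (fun x => (complex.Re (f x))%:E) /\
  mu.-integrable [set: 'rV[R]_n] (fun x => (complex.Im (f x))%:E).

Definition cintegral f : R[i] :=
  Complex (\int[mu]_x complex.Re (f x))%R (\int[mu]_x complex.Im (f x))%R.

End complex_integral.

Section schwartz.
Context {R : realType} {n : nat}.
Implicit Types (x : 'rV[R]_n) (f : 'rV[R]_n -> R[i]).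

Definition dotp (x y : 'rV[R]_n) : R := \sum_i x ord0 i * y ord0 i.

(* Explicitly Euclidean: the library norm on row vectors is the max norm. *)
Definition japanese_bracket x : R := Num.sqrt (1 + dotp x x).

Definition partial (i : 'I_n) f : 'rV[R]_n -> R[i] := fun x =>
  Complex ('D_(delta_mx ord0 i) (fun y => complex.Re (f y)) x)
          ('D_(delta_mx ord0 i) (fun y => complex.Im (f y)) x).

(* A sequence of directions plays the role of a multi-index; on smooth
   functions the order of the directions is irrelevant. *)
Definition partials (s : seq 'I_n) f : 'rV[R]_n -> R[i] := foldr partial f s.

Definition smooth f := forall s x,
  differentiable (fun y => complex.Re (partials s f y)) x /\
  differentiable (fun y => complex.Im (partials s f y)) x.

Definition schwartz_seminorm k s f : \bar R := ereal_sup
  [set (japanese_bracket x ^+ k * normc (partials s f x))%:E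
     | x in [set: 'rV[R]_n]].

Definition schwartz f :=
  smooth f /\ forall k s, (schwartz_seminorm k s f < +oo)%E.

(* The convention for which the Laplacian is multiplication by -|xi|^2. *)
Definition fourier f : 'rV[R]_n -> R[i] := fun xi =>
  cintegral (fun x => f x * Complex (cos (dotp x xi)) (- sin (dotp x xi))).

End schwartz.

(* Only the values on Schwartz functions are constrained or ever used.
   Continuity is for the topology generated by the Schwartz seminorms. *)
Record tempered_distribution (R : realType) (n : nat) := TemperedDistribution {
  td_fun :> ('rV[R]_n -> R[i]) -> R[i] ;
  td_linear : forall (a : R[i]) (phi psi : 'rV[R]_n -> R[i]),
    schwartz phi -> schwartz psi ->
    td_fun (fun x => a * phi x + psi x) = a * td_fun phi + td_fun psi ;
  td_continuous : forall phi : 'rV[R]_n -> R[i], schwartz phi ->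
    forall e : R, 0 < e -> exists2 delta : R, 0 < delta & exists N : nat,
    forall psi : 'rV[R]_n -> R[i], schwartz psi ->
    (forall k s, (k <= N)%N -> (size s <= N)%N ->
      (schwartz_seminorm k s (fun x => psi x - phi x)%R < delta%:E)%E) ->
    normc (td_fun psi - td_fun phi) < e
}.

Section spectral_barron.
Context {R : realType} {n : nat}.
Implicit Types u : tempered_distribution R n.

(* The Fourier transform of u, defined by duality, is the regular
   distribution with density f. *)
Definition is_fourier_transform u (f : 'rV[R]_n -> R[i]) :=
  cmeasurable f /\
  forall phi, schwartz phi ->
    cintegrable (fun xi => f xi * phi xi) /\
    u (fourier phi) = cintegral (fun xi => f xi * phi xi).

(* A density is unique up to a null set, so any choice gives the same norms. *)
Definition fourier_transform u : 'rV[R]_n -> R[i] :=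
  xget (fun=> 0) [set f | is_fourier_transform u f].

Definition barron_norm (s : R) u : \bar R :=
  (\int[lebesgue_rV R n]_xi
    (normc (fourier_transform u xi)
      * japanese_bracket xi `^ s)%R%:E)%E.

Definition barron_space (s : R) : set (tempered_distribution R n) :=
  [set u | (exists f, is_fourier_transform u f) /\ (barron_norm s u < +oo)%E].

End spectral_barron.

(* Main.v *)
Require Import Defs.
From mathcomp Require Import all_boot all_order all_algebra.
From mathcomp Require Import all_classical all_reals all_analysis.
From mathcomp Require Import measurable_realfun ring.
Import Order.TTheory GRing.Theory Num.Theory.
Local Open Scope ring_scope.

(** The Barron norms of [u] are integrals against one measure of the densities
    [|f| w ^ s], where [f] is the Fourier transform of [u] and [w] is the
    Japanese bracket. Since [s = theta r + (1 - theta) t], the density of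
    exponent [s] is pointwise the weighted geometric mean
    [(|f| w ^ r) ^ theta (|f| w ^ t) ^ (1 - theta)]
    ([powR_convex_combination]), and Hoelder's inequality bounds the integral
    of a geometric mean by the geometric mean of the integrals
    ([le_integral_geometric_mean]). The constant is therefore [C = 1]. What
    remains is the measurability of the densities. *)

(** Hoelder's inequality for [F ^ a] and [G ^ (1 - a)] with the conjugate
    exponents [1 / a] and [1 / (1 - a)], whose norms are powers of the integrals
    of [F] and [G]. Integrals may be infinite. *)
Lemma le_integral_geometric_mean (d : measure_display) (T : measurableType d)
    (R : realType) (mu : {measure set T -> \bar R}) (F G : T -> R) (a : R) :
  0 < a < 1 ->
  measurable_fun [set: T] F -> measurable_fun [set: T] G ->
  (forall x, 0 <= F x) -> (forall x, 0 <= G x) ->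
  (\int[mu]_x (F x `^ a * G x `^ (1 - a))%:E <=
    (\int[mu]_x (F x)%:E) `^ a * (\int[mu]_x (G x)%:E) `^ (1 - a))%E.
Proof.
move=> /andP[a0 a1] mF mG F0 G0.
have b0 : 0 < 1 - a by rewrite subr_gt0.
have mpow (H : T -> R) (e : R) : measurable_fun [set: T] H ->
    measurable_fun [set: T] (fun x => H x `^ e).
  exact: (measurableT_comp (measurable_powR e)).
have normK (H : T -> R) (e : R) : 0 < e -> (forall x, 0 <= H x) ->
    ('N[mu]_(e^-1)%:E [EFin \o (fun x => H x `^ e)%R] =
      (\int[mu]_x (H x)%:E) `^ e)%E.
  move=> e0 H0; rewrite unlock invrK; congr (_ `^ _)%E.
  apply: eq_integral => x _; rewrite abse_EFin ger0_norm ?powR_ge0//.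
  by rewrite poweR_EFin -powRrM mulfV ?gt_eqF// powRr1.
rewrite -normK// -normK//.
have := @hoelder _ _ _ mu _ _ a^-1 (1 - a)^-1 (mpow F a mF) (mpow G (1 - a) mG).
rewrite !invr_gt0 !invrK subrKC => /(_ a0 b0 erefl); apply: le_trans.
rewrite Lnorm1 le_eqVlt; apply/orP; left; apply/eqP/eq_integral => x _.
by rewrite abse_EFin ger0_norm ?mulr_ge0 ?powR_ge0.
Qed.

(** The factor [n] is raised to the exponents [a] and [1 - a], which add up to
    one. The exponents of [w] add up for any sum, since [w] is nonzero. *)
Lemma powR_convex_combination (R : realType) (n w r t a : R) :
  0 <= n -> 0 < w ->
  n * w `^ (a * r + (1 - a) * t) =
    (n * w `^ r) `^ a * (n * w `^ t) `^ (1 - a).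
Proof.
move=> n0 w0.
rewrite !powRM ?powR_ge0// mulrACA -powRD; last first.
  by rewrite subrKC oner_eq0.
rewrite subrKC powRr1// -!powRrM -powRD ?(gt_eqF w0) ?implybT//.
by rewrite (mulrC r) (mulrC t).
Qed.

Lemma measurable_normc (d : measure_display) (T : measurableType d)
    (R : realType) (f : T -> R[i]) :
  measurable_fun [set: T] (fun x => complex.Re (f x)) ->
  measurable_fun [set: T] (fun x => complex.Im (f x)) ->
  measurable_fun [set: T] (fun x => ComplexField.Normc.normc (f x)).
Proof.
move=> mRe mIm.
have -> : (fun x => ComplexField.Normc.normc (f x)) =
    Num.sqrt \o (fun x => complex.Re (f x) ^+ 2 + complex.Im (f x) ^+ 2).
  by apply/funext => x /=; case: (f x).
apply: measurableT_comp.
  by apply: continuous_measurable_fun; exact: sqrt_continuous.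
by apply: measurable_funD; exact: measurable_funX.
Qed.

Lemma measurable_japanese_bracket (R : realType) (n : nat) :
  measurable_fun [set: 'rV[R]_n] (@japanese_bracket R n).
Proof.
apply: (@measurableT_comp _ _ _ _ _ _ (@Num.sqrt R)).
  by apply: continuous_measurable_fun; exact: sqrt_continuous.
apply: measurable_funD => //; apply: measurable_sum => i.
by apply: measurable_funM; exact: measurable_coord.
Qed.

Lemma japanese_bracket_gt0 (R : realType) (n : nat) (x : 'rV[R]_n) :
  0 < japanese_bracket x.
Proof.
rewrite sqrtr_gt0 ltr_pwDl// sumr_ge0// => i _.
by rewrite -expr2 sqr_ge0.
Qed.

Lemma measurable_barron_integrand (R : realType) (n : nat)
    (f : 'rV[R]_n -> R[i]) (s : R) : cmeasurable f ->
  measurable_fun [set: 'rV[R]_n] (fun xi =>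
    ComplexField.Normc.normc (f xi) * japanese_bracket xi `^ s).
Proof.
move=> [mRe mIm]; apply: measurable_funM; first exact: measurable_normc.
apply: (measurableT_comp (measurable_powR s)).
exact: measurable_japanese_bracket.
Qed.

Theorem theorem2p3 (R : realType) (d : nat) (r s t : R) :
  r < s -> s < t ->
  let theta := (t - s) / (t - r) in
  0 < theta < 1 /\
  exists C : R, forall u : tempered_distribution R d, barron_space t u ->
    (barron_norm s u <=
      C%:E * barron_norm r u `^ theta * barron_norm t u `^ (1 - theta))%E.
Proof.
move=> rs st theta.
have tr : 0 < t - r by rewrite subr_gt0 (lt_trans rs).
have theta01 : 0 < theta < 1.
  by rewrite divr_gt0 ?(subr_gt0 s t)//= ltr_pdivrMr// mul1r ltrD2l ltrN2.
have sE : s = theta * r + (1 - theta) * t.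
  by rewrite /theta; field; rewrite gt_eqF.
split=> //; exists 1 => u [[f uf] _]; rewrite mul1e.
(* The Fourier transform is chosen among the densities of [u], so existence of
   one density makes the chosen one measurable. *)
have [mf _] : is_fourier_transform u (fourier_transform u).
  exact: (xgetPex (fun=> 0) (ex_intro _ f uf)).
have normc0 z : 0 <= ComplexField.Normc.normc z :> R.
  by case: z => a b; exact: sqrtr_ge0.
rewrite {1}/barron_norm; under eq_integral => xi _.
  rewrite {1}sE powR_convex_combination ?japanese_bracket_gt0//.
  over.
apply: le_integral_geometric_mean => //.
- exact: measurable_barron_integrand.
- exact: measurable_barron_integrand.
- by move=> xi; rewrite mulr_ge0 ?powR_ge0.
- by move=> xi; rewrite mulr_ge0 ?powR_ge0.
Qed.
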